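(* Let $F_t(z)=z-tH(z)\in\mathbb E_t^{[\alpha]}\langle\langle z\rangle\rangle$ with inverse map $G_t(z)=z+tN_t(z)$, $N_t(z)=\sum_{m\ge1}t^{m-1}N_{[m]}(z)$. Then $N_{[1]}(z)=H(z)$ and, for any $m\ge2$, $$N_{[m]}(z)=\frac{m}{m-1}\sum_{\substack{I=(i_1,\dots,i_k)\in\mathcal C_m\\ k=\ell(I)\ge2}}\frac1{\pi_u(\bar I)}\Big[N_{[i_1]}\frac{\partial}{\partial z}\Big]\cdots\Big[N_{[i_{k-1}]}\frac{\partial}{\partial z}\Big]N_{[i_k]}(z).$$
   Context: $K$ is a unital commutative $\mathbb Q$-algebra, $z=(z_1,\dots,z_n)$ are commutative or noncommutative free variables, and $t$ is a formal parameter commuting with $z$ and $K$. $K\langle\langle z\rangle\rangle$ and $K[[t]]\langle\langle z\rangle\rangle$ are the formal power series algebras in $z$ (in either the commutative or the noncommutative case); $o(\cdot)$ is the order in $z$. For $\alpha\ge1$, $\mathbb E_t^{[\alpha]}\langle\langle z\rangle\rangle$ is the set of automorphisms of $K[[t]]\langle\langle z\rangle\rangle$ over $K[[t]]$ of the form $F_t(z)=z-tH(z)$ with $H(z)\in K\langle\langle z\rangle\rangle^{\times n}$, $o(H(z))\ge\alpha$. Its inverse map $G_t=F_t^{-1}$ is written $G_t(z)=z+tN_t(z)$, and $N_{[m]}(z)\in K\langle\langle z\rangle\rangle^{\times n}$ ($m\ge1$) are defined by $N_t(z)=\sum_{m\ge1}t^{m-1}N_{[m]}(z)$. For a vector $\vec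 u=(u_1,\dots,u_n)$ of power series, $[\vec u\frac{\partial}{\partial z}]$ is the derivation sending $z_i$ to $u_i$; operators are applied to vectors componentwise. A composition is a nonempty finite sequence $I=(i_1,\dots,i_k)$ of positive integers; $\ell(I)=k$, $|I|=i_1+\cdots+i_k$, $\bar I=(i_k,\dots,i_1)$; $\mathcal C_m$ is the set of compositions with $|I|=m$; $\pi_u(I)=\prod_{j=1}^k(i_1+\cdots+i_j)$. *)

(* Defs.v *)
From HB Require Import structures.
From mathcomp Require Import all_boot all_order all_algebra.
From mathcomp Require Import mpoly boolp zify.

Set Implicit Arguments.
Unset Strict Implicit.
Unset Printing Implicit Defensive.

Import GRing.Theory.
Local Open Scope ring_scope.

(******************************************************************************)
(* Formal power series over a monoid M in which every element has finitely    *)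
(* many factorizations.  The three monoids used are                           *)
(*    tpow     the powers of t;  series K tpow = K[[t]]                       *)
(*    cmon n   the commutative monomials in z_1, ..., z_n                     *)
(*    word n   the noncommutative monomials in z_1, ..., z_n                  *)
(* so that K<<z>> is series K (zmon k n), with zmon k n = cmon n or word n    *)
(* according to k, and K[[t]]<<z>> is series (series K tpow) (zmon k n).      *)
(******************************************************************************)

HB.mixin Record Monoid_isLocFinite M of Monoid M := {
  factors : M -> seq (M * M);
  factors_uniq : forall m, uniq (factors m);
  mem_factors : forall m p, (p \in factors m) = ((p.1 * p.2)%g == m)
}.

#[short(type="lfmonoidType")]
HB.structure Definition LocFiniteMonoid :=
  {M of Monoid_isLocFinite M & Monoid M}.

Section FactorTheory.
Variable M : lfmonoidType.
Implicit Types m : M.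

Lemma big_factors3 (V : nmodType) (phi : M -> M -> M -> V) m :
  \sum_(p <- factors m) \sum_(q <- factors p.1) phi q.1 q.2 p.2 =
  \sum_(p <- factors m) \sum_(q <- factors p.2) phi p.1 q.1 q.2.
Proof.
pose F (x : M * M * M) := phi x.1.1 x.1.2 x.2.
rewrite -(big_allpairs_dep (h := fun p q : M * M => (q.1, q.2, p.2))
            (r2 := fun p => factors p.1) (F := F)).
rewrite -(big_allpairs_dep (h := fun p q : M * M => (p.1, q.1, q.2))
            (r2 := fun p => factors p.2) (F := F)).
apply: perm_big; apply: uniq_perm.
- apply: allpairs_uniq_dep => [|p _|]; rewrite ?factors_uniq //.
  move=> [[p1 p2] [q1 q2]] [[p1' p2'] [q1' q2']] /=.
  move=> /allpairsPdep[p [q [_ + e]]] /allpairsPdep[p' [q' [_ + e']]].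
  move: (congr1 (@projT1 _ _) e) (congr1 (fun x : {_ : _ & (M * M)%type} => tagged x) e) => /= <- <-.
  move: (congr1 (@projT1 _ _) e') (congr1 (fun x : {_ : _ & (M * M)%type} => tagged x) e') => /= <- <-.
  by rewrite !mem_factors /= => /eqP<- /eqP<- [-> -> ->].
- apply: allpairs_uniq_dep => [|p _|]; rewrite ?factors_uniq //.
  move=> [[p1 p2] [q1 q2]] [[p1' p2'] [q1' q2']] /=.
  move=> /allpairsPdep[p [q [_ + e]]] /allpairsPdep[p' [q' [_ + e']]].
  move: (congr1 (@projT1 _ _) e) (congr1 (fun x : {_ : _ & (M * M)%type} => tagged x) e) => /= <- <-.
  move: (congr1 (@projT1 _ _) e') (congr1 (fun x : {_ : _ & (M * M)%type} => tagged x) e') => /= <- <-.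
  by rewrite !mem_factors /= => /eqP<- /eqP<- [-> -> ->].
move=> [[a b] c]; apply/allpairsPdep/allpairsPdep => /=.
- case=> p [q [+ + [-> -> ->]]]; rewrite !mem_factors => /eqP <- /eqP <-.
  exists (q.1, q.2 * p.2)%g, (q.2, p.2).
  by rewrite !mem_factors /= mulgA !eqxx.
- case=> p [q [+ + [-> -> ->]]]; rewrite !mem_factors => /eqP <- /eqP <-.
  exists (p.1 * q.1, q.2)%g, (p.1, q.1).
  by rewrite !mem_factors /= mulgA !eqxx.
Qed.

Lemma big_factors1l (R : nzSemiRingType) (phi : M -> R) m :
  \sum_(p <- factors m) (p.1 == 1%g)%:R * phi p.2 = phi m.
Proof.
rewrite (bigD1_seq (1%g, m)) ?factors_uniq ?mem_factors ?mul1g //= eqxx mul1r.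
rewrite big_seq_cond big1 ?addr0 // => -[a b] /=; rewrite mem_factors /=.
by case: (a =P 1%g) => [->|_]; rewrite ?mul0r // mul1g xpair_eqE eqxx andbN.
Qed.

Lemma big_factors1r (R : nzSemiRingType) (phi : M -> R) m :
  \sum_(p <- factors m) phi p.1 * (p.2 == 1%g)%:R = phi m.
Proof.
rewrite (bigD1_seq (m, 1%g)) ?factors_uniq ?mem_factors ?mulg1 //= eqxx mulr1.
rewrite big_seq_cond big1 ?addr0 // => -[a b] /=; rewrite mem_factors /=.
by case: (b =P 1%g) => [->|_]; rewrite ?mulr0 // mulg1 xpair_eqE eqxx andbT andbN.
Qed.

End FactorTheory.

Record series (R : Type) (M : Type) := Series { scoef :> M -> R }.

Definition seriesX (R : pzSemiRingType) (M : eqType) (m : M) : series R M :=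
  Series (fun w => (w == m)%:R).

Lemma seriesP R M (f g : series R M) : f =1 g <-> f = g.
Proof.
by split=> [|->//]; case: f g => [f] [g] /= h; congr Series; apply/funext.
Qed.

HB.instance Definition _ R M := gen_eqMixin (series R M).
HB.instance Definition _ R M := gen_choiceMixin (series R M).

Section SeriesZmod.
Variables (R : zmodType) (M : Type).
Implicit Types f g : series R M.

Definition series0 : series R M := Series (fun _ => 0).
Definition series_opp f : series R M := Series (fun w => - f w).
Definition series_add f g : series R M := Series (fun w => f w + g w).

Fact series_addA : associative series_add.
Proof. by move=> f g h; apply/seriesP => w /=; rewrite addrA. Qed.
Fact series_addC : commutative series_add.
Proof. by move=> f g; apply/seriesP => w /=; rewrite addrC. Qed.
Fact series_add0 : left_id series0 series_add.
Proof. by move=> f; apply/seriesP => w /=; rewrite add0r. Qed.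
Fact series_addN : left_inverse series0 series_opp series_add.
Proof. by move=> f; apply/seriesP => w /=; rewrite addNr. Qed.

HB.instance Definition _ := GRing.isZmodule.Build (series R M)
  series_addA series_addC series_add0 series_addN.

Lemma scoef0 w : (0 : series R M) w = 0. Proof. by []. Qed.
Lemma scoefN f w : (- f) w = - f w. Proof. by []. Qed.
Lemma scoefD f g w : (f + g) w = f w + g w. Proof. by []. Qed.
Lemma scoefB f g w : (f - g) w = f w - g w. Proof. by []. Qed.
Lemma scoef_sum (I : Type) (r : seq I) (P : pred I) (F : I -> series R M) w :
  (\sum_(i <- r | P i) F i) w = \sum_(i <- r | P i) F i w.
Proof. by elim/big_rec2: _ => // i x y _ <-. Qed.
End SeriesZmod.

Section SeriesRing.
Variables (R : nzRingType) (M : lfmonoidType).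
Implicit Types f g h : series R M.

Definition series1 : series R M := seriesX R 1%g.
Definition series_mul f g : series R M :=
  Series (fun w => \sum_(p <- factors w) f p.1 * g p.2).

Fact series_mulA : associative series_mul.
Proof.
move=> f g h; apply/seriesP => w /=.
under eq_bigr do rewrite mulr_sumr.
under [RHS]eq_bigr do rewrite mulr_suml.
rewrite (big_factors3 (fun a b c => f a * g b * h c)).
by under eq_bigr do under eq_bigr do rewrite mulrA.
Qed.
Fact series_mul1 : left_id series1 series_mul.
Proof. by move=> f; apply/seriesP => w /=; rewrite big_factors1l. Qed.
Fact series_1mul : right_id series1 series_mul.
Proof. by move=> f; apply/seriesP => w /=; rewrite big_factors1r. Qed.
Fact series_mulDl : left_distributive series_mul +%R.
Proof.
move=> f g h; apply/seriesP => w /=.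
by rewrite -big_split; apply: eq_bigr => p _ /=; rewrite mulrDl.
Qed.
Fact series_mulDr : right_distributive series_mul +%R.
Proof.
move=> f g h; apply/seriesP => w /=.
by rewrite -big_split; apply: eq_bigr => p _ /=; rewrite mulrDr.
Qed.
Fact series1_neq0 : series1 != 0.
Proof.
apply/eqP => /seriesP/(_ 1%g) /= /eqP.
by rewrite eqxx oner_eq0.
Qed.

HB.instance Definition _ := GRing.Zmodule_isNzRing.Build (series R M)
  series_mulA series_mul1 series_1mul series_mulDl series_mulDr series1_neq0.

Lemma scoefM f g w : (f * g) w = \sum_(p <- factors w) f p.1 * g p.2.
Proof. by []. Qed.

Definition series_scale (a : R) f : series R M := Series (fun w => a * f w).

Fact series_scaleA a b f :
  series_scale a (series_scale b f) = series_scale (a * b) f.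
Proof. by apply/seriesP => w /=; rewrite mulrA. Qed.
Fact series_scale1 : left_id 1 series_scale.
Proof. by move=> f; apply/seriesP => w /=; rewrite mul1r. Qed.
Fact series_scaleDr : right_distributive series_scale +%R.
Proof. by move=> a f g; apply/seriesP => w; rewrite /= mulrDr. Qed.
Fact series_scaleDl f : {morph series_scale^~ f : a b / a + b}.
Proof. by move=> a b; apply/seriesP => w; rewrite /= mulrDl. Qed.

HB.instance Definition _ := GRing.Zmodule_isLmodule.Build R (series R M)
  series_scaleA series_scale1 series_scaleDr series_scaleDl.

Lemma scoefZ a f w : (a *: f) w = a * f w. Proof. by []. Qed.

Fact series_scaleAl (a : R) f g : a *: (f * g) = (a *: f) * g.
Proof.
apply/seriesP => w; rewrite scoefZ !scoefM mulr_sumr.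
by apply: eq_bigr => p _; rewrite scoefZ mulrA.
Qed.

HB.instance Definition _ :=
  GRing.Lmodule_isLalgebra.Build R (series R M) series_scaleAl.
End SeriesRing.

Section SeriesAlg.
Variables (R : comNzRingType) (M : lfmonoidType).

Fact series_scaleAr (a : R) (f g : series R M) : a *: (f * g) = f * (a *: g).
Proof.
apply/seriesP => w; rewrite scoefZ !scoefM mulr_sumr.
by apply: eq_bigr => p _; rewrite scoefZ mulrCA.
Qed.

HB.instance Definition _ :=
  GRing.Lalgebra_isAlgebra.Build R (series R M) series_scaleAr.
End SeriesAlg.

(* The monoid of powers of t: j : tpow stands for t^j. *)
Definition tpow := nat.
HB.instance Definition _ := Choice.copy tpow nat.
HB.instance Definition _ := isMonoid.Build tpow addnA add0n addn0.

Section TFactors.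
Definition tfactors (m : tpow) : seq (tpow * tpow) :=
  [seq (j, (m - j)%N) | j <- iota 0 m.+1].

Fact tfactors_uniq m : uniq (tfactors m).
Proof. by rewrite map_inj_uniq ?iota_uniq // => i j []. Qed.
Fact mem_tfactors (m : tpow) p : (p \in tfactors m) = ((p.1 * p.2)%g == m).
Proof.
case: p => a b; apply/mapP/eqP => [[j]|<-].
  by rewrite mem_iota ltnS => /andP[_ lejm] [-> ->]; apply: subnKC.
by exists a; rewrite ?mem_iota ?ltnS ?leq_addr //= addKn.
Qed.
HB.instance Definition _ :=
  Monoid_isLocFinite.Build tpow tfactors_uniq mem_tfactors.
End TFactors.

Section TSeriesCom.
Variable R : comNzRingType.

Fact tseries_mulC : commutative (@GRing.mul (series R tpow)).
Proof.
move=> f g; apply/seriesP => m; rewrite !scoefM.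
rewrite -(big_map (fun p => (p.2, p.1)) predT (fun p => f p.2 * g p.1)).
under eq_bigr do rewrite mulrC.
apply: perm_big; apply: uniq_perm; rewrite ?factors_uniq //.
  by rewrite map_inj_uniq ?factors_uniq // => -[a b] [c d] [-> ->].
move=> [a b]; rewrite mem_factors; apply/mapP/eqP => [[[c d]]|<-].
  by rewrite mem_factors => /eqP <- [-> ->]; apply: addnC.
by exists (b, a); rewrite // mem_factors /=; apply/eqP/addnC.
Qed.

HB.instance Definition _ :=
  GRing.PzRing_hasCommutativeMul.Build (series R tpow) tseries_mulC.
End TSeriesCom.

Definition cmon n := 'X_{1..n}.
HB.instance Definition _ n := Choice.copy (cmon n) 'X_{1..n}.
HB.instance Definition _ n :=
  isMonoid.Build (cmon n) (@addmA n) (@add0m n) (@addm0 n).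

Section CFactors.
Variable n : nat.

Definition cfactors (m : cmon n) : seq (cmon n * cmon n) :=
  [seq (bmnm a, (m - a)%MM)
     | a <- enum {: 'X_{1..n < (mdeg m).+1}} & (bmnm a <= m)%MM].

Fact cfactors_uniq m : uniq (cfactors m).
Proof.
rewrite map_inj_uniq ?filter_uniq -?enumT ?enum_uniq // => a b [/eqP].
by rewrite -bmeqP => /eqP.
Qed.
Fact mem_cfactors (m : cmon n) p : (p \in cfactors m) = ((p.1 * p.2)%g == m).
Proof.
case: p => a b; apply/mapP/eqP => /= [[c]|<-].
  by rewrite mem_filter => /andP[lecm _] [-> ->]; apply: etrans (addmC _ _) (submK lecm).
have ltd : (mdeg a < (mdeg (a + b)%MM).+1)%N by rewrite mdegD ltnS leq_addr.
exists (BMultinom ltd); first by rewrite mem_filter -?enumT mem_enum lem_addr.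
by congr pair; apply: etrans (esym (addmK a b)) _; congr mnm_sub; apply: addmC.
Qed.
HB.instance Definition _ :=
  Monoid_isLocFinite.Build (cmon n) cfactors_uniq mem_cfactors.
End CFactors.

Definition word n := seq 'I_n.
HB.instance Definition _ n := Choice.copy (word n) (seq 'I_n).
HB.instance Definition _ n :=
  isMonoid.Build (word n) (@catA 'I_n) (@cat0s 'I_n) (@cats0 'I_n).

Section WFactors.
Variable n : nat.

Definition wfactors (w : word n) : seq (word n * word n) :=
  [seq (take j w, drop j w) | j <- iota 0 (size w).+1].

Fact wfactors_uniq w : uniq (wfactors w).
Proof.
rewrite map_inj_in_uniq ?iota_uniq // => i j.
rewrite !mem_iota !ltnS => /andP[_ lei] /andP[_ lej] [/(congr1 size)].
by rewrite !size_takel.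
Qed.
Fact mem_wfactors (w : word n) p : (p \in wfactors w) = ((p.1 * p.2)%g == w).
Proof.
case: p => a b; apply/mapP/eqP => [[j _ [-> ->]]|<-].
  exact: cat_take_drop.
exists (size a); last by rewrite take_size_cat ?drop_size_cat.
rewrite mem_iota ltnS; have -> : size ((a, b).1 * (a, b).2)%g = (size a + size b)%N.
  exact: size_cat.
exact: leq_addr.
Qed.
HB.instance Definition _ :=
  Monoid_isLocFinite.Build (word n) wfactors_uniq mem_wfactors.
End WFactors.

Variant zkind := Commutative | Noncommutative.

Definition zmon (k : zkind) (n : nat) : lfmonoidType :=
  match k with Commutative => cmon n | Noncommutative => word n end.

Definition zdeg (k : zkind) (n : nat) : zmon k n -> nat :=
  match k with
  | Commutative => fun m : cmon n => mdeg m
  | Noncommutative => fun w : word n => size w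
  end.

Definition zmon1 (k : zkind) (n : nat) (i : 'I_n) : zmon k n :=
  match k return zmon k n with
  | Commutative => U_(i)%MM : cmon n
  | Noncommutative => [:: i] : word n
  end.

Definition zvar (R : pzSemiRingType) (k : zkind) (n : nat) (i : 'I_n) :
    series R (zmon k n) :=
  seriesX R (zmon1 k i).

(* The derivation [u d/dz] of R<<z>>, i.e. the one sending z_i to u_i.  On a
   commutative series f it is \sum_i u_i * df/dz_i.  On a noncommutative series
   it replaces, in turn, each occurrence of each letter z_i by u_i, so that the
   coefficient of the word w in the image of f is the sum of
   f(a z_i c) * u_i(b) over all i and all factorizations w = a b c. *)
Section Derivations.
Variables (R : comNzRingType) (n : nat).

Definition cvar (i : 'I_n) : cmon n := U_(i)%MM.

Definition cpartial (i : 'I_n) (f : series R (cmon n)) : series R (cmon n) :=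
  Series (fun m => f (m * cvar i)%g *+ (m i).+1).

Definition cder (u : 'I_n -> series R (cmon n)) (f : series R (cmon n)) :
    series R (cmon n) :=
  \sum_(i < n) u i * cpartial i f.

Definition wder (u : 'I_n -> series R (word n)) (f : series R (word n)) :
    series R (word n) :=
  Series (fun w : word n =>
    \sum_(p <- factors w) \sum_(q <- factors p.2) \sum_(i < n)
      f (p.1 ++ i :: q.2) * u i q.1).

Fact cmulC : commutative (@GRing.mul (series R (cmon n))).
Proof.
move=> f g; apply/seriesP => m; rewrite !scoefM.
rewrite -(big_map (fun p => (p.2, p.1)) predT (fun p => f p.2 * g p.1)).
under eq_bigr do rewrite mulrC.
apply: perm_big; apply: uniq_perm; rewrite ?factors_uniq //.
  by rewrite map_inj_uniq ?factors_uniq // => -[a b] [c d] [-> ->].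
move=> [a b]; rewrite mem_factors; apply/mapP/eqP => [[[c d]]|<-].
  by rewrite mem_factors => /eqP <- [-> ->]; apply: addmC.
by exists (b, a); rewrite // mem_factors /=; apply/eqP/addmC.
Qed.

Fact big_factors_swap (F : cmon n -> cmon n -> R) (m : cmon n) :
  \sum_(p <- factors m) F p.1 p.2 = \sum_(p <- factors m) F p.2 p.1.
Proof.
pose sw (p : cmon n * cmon n) : cmon n * cmon n := (p.2, p.1).
rewrite -[RHS](big_map sw predT (fun p => F p.1 p.2)).
have sw_inj : injective sw by move=> [a b] [c d] [-> ->].
apply: perm_big; apply: uniq_perm; first exact: factors_uniq.
  by rewrite (map_inj_uniq sw_inj) factors_uniq.
move=> [a b]; rewrite mem_factors; apply/eqP/mapP => [<-|[[c d]]].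
  by exists (b, a); rewrite // mem_factors; apply/eqP/addmC.
by rewrite mem_factors => /eqP <- [-> ->]; apply: addmC.
Qed.

Fact cmulgAC (a b c : cmon n) : (a * b * c)%g = (a * c * b)%g.
Proof. by rewrite -!mulgA; congr (_ * _)%g; apply: addmC. Qed.

Fact cmul_inj i : injective (fun a : cmon n => (a * cvar i)%g).
Proof. exact: (can_inj (addmK U_(i)%MM)). Qed.

Fact big_factors_shift i (F : cmon n -> cmon n -> R) (m : cmon n) :
  \sum_(p <- factors m) F (p.1 * cvar i)%g p.2 *+ (p.1 i).+1 =
  \sum_(p <- factors (m * cvar i)%g) F p.1 p.2 *+ p.1 i.
Proof.
pose sh (p : cmon n * cmon n) : cmon n * cmon n := ((p.1 * cvar i)%g, p.2).
have shE (p : cmon n) : (p * cvar i)%g i = (p i).+1.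
  by rewrite [LHS]mnmDE mnm1E eqxx addn1.
have sh_inj : injective sh.
  by move=> [a b] [c d] E; move: (congr1 fst E) (congr1 snd E) => /cmul_inj /= -> ->.
rewrite [RHS](bigID (fun p : cmon n * cmon n => p.1 i == 0%N)) /=.
rewrite [X in X + _]big1 ?add0r => [|p /eqP -> //].
rewrite -[RHS]big_filter.
transitivity (\sum_(p <- map sh (factors m)) F p.1 p.2 *+ p.1 i).
  rewrite [RHS](big_map sh predT (fun p => F p.1 p.2 *+ p.1 i)).
  by apply: eq_bigr => p _; rewrite shE.
apply: perm_big; apply: uniq_perm.
- by rewrite (map_inj_uniq sh_inj) factors_uniq.
- by rewrite filter_uniq ?factors_uniq.
move=> [a b]; rewrite mem_filter mem_factors.
apply/mapP/andP => [[[c d]]|[a0 /eqP e]].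
  rewrite mem_factors => /eqP <- [-> ->]; rewrite shE; split=> //.
  by apply/eqP; apply: cmulgAC.
have le1 : (U_(i) <= (a : 'X_{1..n}))%MM.
  by apply/mnm_lepP => j; rewrite mnm1E; case: eqP => // <-; rewrite lt0n.
pose a' : cmon n := (a - U_(i))%MM.
have Ea : a = (a' * cvar i)%g by apply: esym; apply: submK.
exists (a', b); last by rewrite Ea.
rewrite mem_factors; apply/eqP; apply: (@cmul_inj i); rewrite -e Ea.
exact: cmulgAC.
Qed.

Fact cpartialM i f g :
  cpartial i (f * g) = cpartial i f * g + f * cpartial i g.
Proof.
apply/seriesP => m; rewrite scoefD [f * cpartial i g]cmulC !scoefM.
transitivity (\sum_(p <- factors (m * cvar i)%g)
    (f p.1 * g p.2 *+ p.1 i + f p.1 * g p.2 *+ p.2 i)).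
  rewrite -[LHS]/((f * g) (m * cvar i)%g *+ (m i).+1) scoefM -sumrMnl; apply: eq_big_seq => p.
  rewrite mem_factors => /eqP e; rewrite -mulrnDr; congr (_ *+ _).
  have : (p.1 * p.2)%g i = (m * cvar i)%g i by rewrite e.
  by rewrite [LHS]mnmDE [RHS]mnmDE mnm1E eqxx addn1 => ->.
rewrite big_split; congr (_ + _).
  rewrite -(big_factors_shift i (fun a b => f a * g b)).
  by apply: eq_bigr => p _; rewrite /= mulrnAl.
rewrite (big_factors_swap (fun a b => f a * g b *+ b i)).
rewrite -(big_factors_shift i (fun a b => f b * g a)).
by apply: eq_bigr => p _; rewrite /= mulrnAl [f _ * _]mulrC.
Qed.

Fact cder_is_linear u : linear (cder u).
Proof.
move=> a f g; rewrite /cder scaler_sumr -big_split; apply: eq_bigr => i _ /=.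
rewrite scalerAr -mulrDr; congr (_ * _); apply/seriesP => m.
by rewrite scoefD scoefZ /= mulrnDl mulrnAr.
Qed.

Fact cderM u f g : cder u (f * g) = cder u f * g + f * cder u g.
Proof.
rewrite /cder mulr_suml mulr_sumr -big_split; apply: eq_bigr => i _ /=.
by rewrite cpartialM mulrDr mulrA mulrA [u i * f]cmulC -!mulrA.
Qed.

Fact cder_var u i : cder u (seriesX R (cvar i)) = u i.
Proof.
rewrite /cder (bigD1 i) //= big1 => [|j ji].
  rewrite addr0 -[RHS]mulr1; congr (_ * _); apply/seriesP => m /=.
  rewrite -[X in _ == X]mul1g (inj_eq (@cmul_inj i)).
  by case: eqP => [->|_]; rewrite ?mnm0E ?mul0rn.
rewrite -[RHS](mulr0 (u j)); congr (_ * _); apply/seriesP => m /=.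
case: eqP => [/(congr1 (fun m : cmon n => m j))|_]; last by rewrite mul0rn.
by rewrite [LHS]mnmDE !mnm1E eqxx eq_sym (negPf ji) addn1.
Qed.

Fact big_factors_word (phi : word n -> word n -> R) (a c : word n) (i : 'I_n) :
  \sum_(r <- factors (a ++ i :: c : word n)) phi r.1 r.2 =
  \sum_(r <- factors a) phi r.1 (r.2 ++ i :: c) +
  \sum_(s <- factors c) phi (a ++ i :: s.1) s.2.
Proof.
have FE (w : word n) (G : word n -> word n -> R) :
    \sum_(r <- factors w) G r.1 r.2 =
    \sum_(0 <= j < (size w).+1) G (take j w) (drop j w).
  by rewrite /index_iota subn0 -(big_map (fun j => (take j w, drop j w)) predT
    (fun r => G r.1 r.2)).
rewrite (FE _ (fun x y => phi x (y ++ i :: c))).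
rewrite (FE _ (fun x y => phi (a ++ i :: x) y)) FE.
have -> : size (a ++ i :: c) = ((size c).+1 + size a)%N.
  by rewrite size_cat addnC.
rewrite (@big_cat_nat _ _ _ (size a).+1) //=; last by rewrite ltnS leq_addl.
congr (_ + _).
  apply: eq_big_nat => j /andP[_]; rewrite ltnS => lej.
  rewrite takel_cat // drop_cat; case: ltngtP lej => // -> _.
  by rewrite subnn drop0 drop_size.
rewrite -[X in \sum_(X <= _ < _) _]add0n big_addn subSS addnK.
apply: eq_big_nat => j _.
rewrite take_cat drop_cat ltnNge (leq_trans (leqnSn _) (leq_addl _ _)) /=.
by rewrite -addSnnS addnK.
Qed.

Fact wder_is_linear u : linear (wder u).
Proof.
move=> a f g; apply/seriesP => w; rewrite scoefD scoefZ /=.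
rewrite mulr_sumr -big_split; apply: eq_bigr => p _.
rewrite mulr_sumr -big_split; apply: eq_bigr => q _.
rewrite mulr_sumr -big_split; apply: eq_bigr => i _ /=.
by rewrite mulrDl mulrA.
Qed.

Fact wderM u f g : wder u (f * g) = wder u f * g + f * wder u g.
Proof.
apply/seriesP => w; rewrite scoefD !scoefM.
transitivity (\sum_(p <- factors w) \sum_(q <- factors p.2)
   (\sum_(r <- factors p.1) \sum_(i < n) f r.1 * g (r.2 ++ i :: q.2) * u i q.1 +
    \sum_(s <- factors q.2) \sum_(i < n) f (p.1 ++ i :: s.1) * u i q.1 * g s.2)).
  apply: eq_bigr => p _; apply: eq_bigr => q _.
  rewrite exchange_big [X in _ + X]exchange_big -big_split.
  apply: eq_bigr => i _ /=.
  rewrite (big_factors_word (fun a b => f a * g b)) mulrDl !mulr_suml.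
  by congr (_ + _); apply: eq_bigr => s _; rewrite mulrAC.
under eq_bigr do rewrite big_split.
rewrite big_split [RHS]addrC; congr (_ + _).
  under eq_bigr do rewrite exchange_big.
  rewrite (big_factors3 (fun a b c => \sum_(q <- factors c) \sum_(i < n)
    f a * g (b ++ i :: q.2) * u i q.1)).
  apply: eq_bigr => p _; rewrite /= mulr_sumr; apply: eq_bigr => r _.
  rewrite mulr_sumr; apply: eq_bigr => q _.
  by rewrite mulr_sumr; apply: eq_bigr => i _; rewrite mulrA.
pose phi (a b c d : word n) := \sum_(i < n) f (a ++ i :: c) * u i b * g d.
transitivity (\sum_(x <- factors w) \sum_(p <- factors x.1)
                 \sum_(q <- factors p.2) phi p.1 q.1 q.2 x.2); last first.
  apply: eq_bigr => x _; rewrite /= mulr_suml; apply: eq_bigr => p _.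
  rewrite mulr_suml; apply: eq_bigr => q _.
  by rewrite mulr_suml.
rewrite (big_factors3 (fun a b d => \sum_(q <- factors b) phi a q.1 q.2 d)).
apply: eq_bigr => p _ /=.
by rewrite -(big_factors3 (fun b c d => phi p.1 b c d)).
Qed.

Fact wder_var u i : wder u (seriesX R ([:: i] : word n)) = u i.
Proof.
apply/seriesP => w /=.
rewrite -[RHS](big_factors1l (u i)); apply: eq_bigr => -[a w'] _ /=.
rewrite -[X in _ = _ * X](big_factors1r (u i)) mulr_sumr.
apply: eq_bigr => -[b c] _ /=.
rewrite (bigD1 i) //= big1 ?addr0 => [|j ji].
  case: a => [|x [|y s]]; rewrite ?eqseq_cons ?andbF ?mul0r //=.
  by rewrite eqxx mul1r mulrC.
case: a => [|x [|y s]]; rewrite /= ?eqseq_cons ?andbF ?mul0r //=.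
by rewrite (negPf ji) mul0r.
Qed.
End Derivations.

Definition zder (R : comNzRingType) (k : zkind) (n : nat) :
    ('I_n -> series R (zmon k n)) -> series R (zmon k n) -> series R (zmon k n) :=
  match k with
  | Commutative => @cder R n
  | Noncommutative => @wder R n
  end.

Section DerivationTheory.
Variables (R : comNzRingType) (k : zkind) (n : nat).
Variable u : 'I_n -> series R (zmon k n).

Lemma zder_is_linear : linear (zder u).
Proof. by case: k u => v; [apply: cder_is_linear | apply: wder_is_linear]. Qed.

Lemma zderM f g : zder u (f * g) = zder u f * g + f * zder u g.
Proof. by case: k u f g => v f g; [apply: cderM | apply: wderM]. Qed.

Lemma zder_var i : zder u (zvar R k i) = u i.
Proof. by case: k u => v; [apply: cder_var | apply: wder_var]. Qed.
End DerivationTheory.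

(* o(f) >= alpha *)
Definition order_ge (R : zmodType) (k : zkind) (n : nat) (alpha : nat)
    (f : series R (zmon k n)) : Prop :=
  forall w, (zdeg w < alpha)%N -> f w = 0.

Section TSeries.
Variables (R : nzRingType) (M : lfmonoidType).

Definition tvar : series R tpow := seriesX R (1%N : tpow).

(* The inclusion of R<<z>> into R[[t]]<<z>>. *)
Definition tconst (f : series R M) : series (series R tpow) M :=
  Series (fun w => (f w)%:A).

(* \sum_(j >= 0) t^j f_j *)
Definition tsum (f : nat -> series R M) : series (series R tpow) M :=
  Series (fun w => Series (fun j : tpow => f j w)).
End TSeries.

Arguments tvar {R}.

(* F is an element of E_t^[alpha]<<z>>, with F(z) = z - t H(z).  An
   automorphism over K[[t]] is a bijective K[[t]]-algebra endomorphism; its map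
   F(z) is the vector of the F(z_i). *)
Definition is_Et (K : comNzRingType) (k : zkind) (n alpha : nat)
    (H : 'I_n -> series K (zmon k n))
    (F : {lrmorphism series (series K tpow) (zmon k n) ->
                     series (series K tpow) (zmon k n)}) : Prop :=
  [/\ bijective F,
      forall i, order_ge alpha (H i) &
      forall i, F (zvar _ k i) = zvar _ k i - tvar *: tconst (H i)].

Fixpoint compositions_rec (fuel m : nat) : seq (seq nat) :=
  if fuel is fuel'.+1 then
    [:: m] :: [seq i :: c | i <- iota 1 m.-1, c <- compositions_rec fuel' (m - i)]
  else [::].

Definition compositions (m : nat) : seq (seq nat) := compositions_rec m m.

Lemma mem_compositions_rec fuel m c : (0 < m <= fuel)%N ->
  (c \in compositions_rec fuel m) =
  [&& c != [::], all (leq 1) c & sumn c == m].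
Proof.
elim: fuel m c => [|fuel IH] m c; first by lia.
move=> /andP[m0 lem] /=; rewrite inE.
case: c => [|i c]; first by apply/allpairsPdep => -[? [? []]].
rewrite eqseq_cons; case: c => [|j c]; rewrite ?addn0 ?andbT ?andbF /=.
  rewrite orbC; case: allpairsPdep => [[x [y [xin yin [_ ey]]]]|_] /=.
    by move: xin yin; rewrite -ey mem_iota => xin; rewrite IH //; lia.
  by rewrite addn0; case: eqP => [->|]; rewrite ?andbF ?m0.
apply/allpairsPdep/idP => [[x [y [xin yin [-> ey]]]]|].
  move: xin yin; rewrite mem_iota -ey => xin; rewrite IH; last by lia.
  by move=> /and3P[_ /= -> /eqP ss]; apply/andP; split; [lia|apply/eqP; lia].
move=> /andP[/and3P[i0 j0 al] /eqP ss].
exists i, (j :: c); rewrite mem_iota; split=> //; first by lia.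
rewrite IH /= ?j0 ?al /=; last by lia.
by apply/eqP; lia.
Qed.

Lemma mem_compositions m c :
  (c \in compositions m) = [&& c != [::], all (leq 1) c & sumn c == m].
Proof.
case: m => [|m]; last by rewrite mem_compositions_rec ?leqnn.
by case: c => // -[|i] c //=; rewrite in_nil addSn andbF.
Qed.

Lemma compositions_uniq m : uniq (compositions m).
Proof.
rewrite /compositions; move: {1}m => fuel; elim: fuel m => //= fuel IH m.
apply/andP; split.
  apply/negP => /allpairsPdep[x [y [_ + [_ ey]]]]; rewrite -ey.
  by case: fuel {IH} => //= fuel; rewrite inE => /allpairsPdep[? [? []]].
apply: allpairs_uniq_dep => [|x _|]; rewrite ?iota_uniq //.
by move=> [x y] [x' y'] _ _ /= [-> ->].
Qed.

Definition pi_u (c : seq nat) : nat :=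
  \prod_(1 <= j < (size c).+1) sumn (take j c).

(* [N_{i_1} d/dz] ... [N_{i_(k-1)} d/dz] N_{i_k} *)
Fixpoint iter_der (K : comNzRingType) (k : zkind) (n : nat)
    (N : nat -> 'I_n -> series K (zmon k n)) (c : seq nat) :
    'I_n -> series K (zmon k n) :=
  match c with
  | [::] => fun _ => 0
  | [:: i] => N i
  | i :: c' => fun j => zder (N i) (iter_der N c' j)
  end.

(* Main.v *)
From HB Require Import structures.
Require Import Defs.
From mathcomp Require Import all_boot all_order all_algebra.
From mathcomp Require Import mpoly boolp zify.
Import GRing.Theory.
Local Open Scope ring_scope.

(** The proof has an analytic half and a combinatorial half.

    The analytic half shows that N_t solves the inviscid Burgers equation
    dN_t/dt = [N_t d/dz] N_t.  Write d_t for the coefficientwise derivative in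
    t.  Conjugating d_t by the automorphism F changes it only by a derivation
    over K[[t]]: in D = d_t - G d_t F the terms that differentiate scalars
    cancel.  On the variables, D z_i = - G (d_t (z_i - t H_i)) = G (H_i), and
    applying G to F z_i = z_i - t H_i gives G (H_i) = N_{t,i}.  A K[[t]]-linear
    derivation of K[[t]]<<z>> is determined by its values on the variables
    (zvar_rigidity), so D = [N_t d/dz] (conj_tder).  Finally F N_{t,i} = H_i is
    constant in t, so D N_{t,i} = d_t N_{t,i}, which is the Burgers equation.
    The coefficient of t^(m-2) in it reads
      (m - 1) N_[m] = \sum_(0 < l < m) [N_[l] d/dz] N_[m-l],
    and the same rigidity, applied to G at t = 0, gives N_[1] = H.

    The combinatorial half lets S_m be the sum of the weighted terms
    pi_u(rev I)^-1 [N_{i_1} d/dz] ... N_{i_k} over all compositions I of m.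
    The last factor of pi_u(rev I) is |I| = m and the others make up pi_u of
    the reversed tail of I, so removing the first part of I gives
      m S_m = N_[m] + \sum_(0 < l < m) [N_[l] d/dz] S_(m-l).
    By induction S_l = N_[l] for l < m, whence
    m S_m = N_[m] + (m - 1) N_[m], that is S_m = N_[m] (sum_wterm_id).  The
    theorem is this identity with the one-part composition, which contributes
    N_[m] / m, moved to the other side. *)

(** * Rigidity: maps determined by their values on the variables *)

Section Head.
Context {k : zkind} {n : nat}.
Implicit Types w : zmon k n.

Lemma zdegM (v w : zmon k n) : zdeg (v * w)%g = (zdeg v + zdeg w)%N.
Proof. by case: k v w => v w; [apply: mdegD | apply: size_cat]. Qed.

Lemma zdeg1 : zdeg (1%g : zmon k n) = 0%N.
Proof. by case: k => //; apply: mdeg0. Qed.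

Lemma zdeg_zmon1 i : zdeg (zmon1 k i : zmon k n) = 1%N.
Proof. by case: k => //; apply: mdeg1. Qed.

Lemma zmon1M_inj i : injective (fun w : zmon k n => (zmon1 k i * w)%g).
Proof.
case: k => /= v w => [e|[] //].
by apply: (@cmul_inj n i); rewrite /= -[LHS]addmC -[RHS]addmC.
Qed.

(** A choice of one variable dividing each nontrivial monomial on the left; in
    the commutative case any choice does. *)
Definition zhead : zmon k n -> option 'I_n :=
  match k with
  | Commutative => fun m : cmon n => [pick i | m i != 0%N]
  | Noncommutative => fun w : word n => ohead w
  end.

Lemma zheadP w :
  match zhead w with
  | None => w = 1%g
  | Some i => exists w', w = (zmon1 k i * w')%g
  end.
Proof.
rewrite /zhead; case: k w => /= [m|[|i w]] //; last by exists w.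
case: pickP => [i mi|m0]; last first.
  by apply/mnmP => i; rewrite mnm0E; apply/eqP; have := m0 i; case: eqP.
exists (m - U_(i))%MM; apply: esym; apply: etrans (addmC _ _) _; apply: submK.
by apply/mnm_lepP => j; rewrite mnm1E; case: eqP => // <-; rewrite lt0n.
Qed.

Variable R : nzRingType.
Implicit Types f g : series R (zmon k n).

Lemma zvarM_coef i g w : (zvar R k i * g) w =
  \sum_(p <- factors w | p.1 == zmon1 k i) g p.2.
Proof.
rewrite scoefM [RHS]big_mkcond; apply: eq_bigr => p _ /=.
by case: eqP => _; rewrite ?mul1r ?mul0r.
Qed.

Lemma order_geM1 d i g : order_ge d g -> order_ge d.+1 (zvar R k i * g).
Proof.
move=> gd w; rewrite zvarM_coef => wd; rewrite big_seq_cond big1 // => -[a b] /=.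
rewrite mem_factors => /= /andP[/eqP ew /eqP ea].
by apply: gd; move: wd; rewrite -ew ea zdegM zdeg_zmon1.
Qed.

Definition quot_head f i : series R (zmon k n) :=
  Series (fun w => let v := (zmon1 k i * w)%g in
                   if zhead v == Some i then f v else 0).

(** Each nonconstant monomial of f is attributed to the single variable z_i
    that zhead picks for it, hence is counted once on the right. *)
Lemma head_decomp f :
  f = (f 1%g)%:A + \sum_i zvar R k i * quot_head f i.
Proof.
apply/seriesP => w; rewrite scoefD scoef_sum scoefZ.
rewrite [(1 : series R _) w](_ : _ = (w == 1%g)%:R) //.
under eq_bigr do rewrite zvarM_coef.
have quotE j (p : zmon k n * zmon k n) : p \in factors w -> p.1 == zmon1 k j ->
    quot_head f j p.2 = if zhead w == Some j then f w else 0.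
  by rewrite mem_factors => /eqP ew /eqP ej; rewrite /quot_head /= -ej ew.
move: (quot_head f) quotE => q quotE.
have := zheadP w; case hw: (zhead w) => [i|]; last first.
  move=> ew; rewrite -ew eqxx mulr1 big1 ?addr0 // => j _.
  rewrite big_seq_cond big1 // => p /andP[pw pj].
  by rewrite (quotE j) // hw.
move=> [w' ew]; rewrite [w == _](_ : _ = false); last first.
  apply/eqP => w1; move: (f_equal (@zdeg k n) w1).
  by rewrite ew zdegM zdeg_zmon1 zdeg1.
rewrite mulr0 add0r (bigD1 i) //= [X in _ + X]big1 => [|j ji]; last first.
  rewrite big_seq_cond big1 // => p /andP[pw pj].
  by rewrite (quotE j) // hw (inj_eq Some_inj) eq_sym (negPf ji).
(* By left cancellation (z_i, w') is the only factorization starting with z_i. *)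
rewrite addr0 -big_filter (_ : filter _ _ = [:: (zmon1 k i, w')]).
  by rewrite big_seq1 (quotE i) ?hw ?eqxx //= mem_factors ew.
apply/perm_small_eq => //; apply: uniq_perm; rewrite ?filter_uniq ?factors_uniq //.
move=> [a b]; rewrite mem_filter mem_factors inE xpair_eqE /=.
case: (a =P _) => //= ->; rewrite ew; apply/eqP/eqP => [|-> //].
exact: zmon1M_inj.
Qed.
End Head.

(** Since f is a constant plus a finite sum of products z_i f_i, a lower bound e
    on the orders of all the values of d improves itself to e + 1: continuity is
    automatic. *)
Lemma zvar_rigidity (R S : nzRingType) (k : zkind) (n : nat)
    (d : {additive series R (zmon k n) -> series S (zmon k n)}) :
    (forall c, d c%:A = 0) ->
    (forall i f, d (zvar R k i * f) = zvar S k i * d f) ->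
  forall f, d f = 0.
Proof.
move=> d0 dz; have dge e : forall f, order_ge e (d f).
  elim: e => [|e IH] f // w we; rewrite [f]head_decomp raddfD raddf_sum d0 add0r.
  by rewrite scoef_sum big1 // => i _; rewrite dz; apply: order_geM1 we.
by move=> f; apply/seriesP => w; apply: (dge (zdeg w).+1).
Qed.

(** * The derivative in t and the value at t = 0 *)

Lemma scoefMn (R : zmodType) (M : Type) (f : series R M) w c :
  (f *+ c) w = f w *+ c.
Proof. by elim: c => // c IH; rewrite !mulrS scoefD IH. Qed.

Section TimeDerivative.
Variable K : comNzRingType.

Definition tder1 (a : series K tpow) : series K tpow :=
  Series (fun j : tpow => a j.+1 *+ j.+1).

Lemma tpow_coefM (a b : series K tpow) (j : tpow) :
  (a * b) j = \sum_(0 <= l < j.+1) a l * b (j - l)%N.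
Proof. by rewrite scoefM /index_iota subn0 [LHS]big_map. Qed.

Lemma tder1M a b : tder1 (a * b) = tder1 a * b + a * tder1 b.
Proof.
apply/seriesP => j; rewrite -[LHS]/((a * b) (j.+1 : tpow) *+ j.+1).
rewrite scoefD !tpow_coefM -sumrMnl /=.
transitivity (\sum_(0 <= l < j.+2) (a l * b (j.+1 - l)%N *+ l +
                                    a l * b (j.+1 - l)%N *+ (j.+1 - l))).
  by apply: eq_big_nat => l /andP[_ lj]; rewrite -mulrnDr subnKC.
rewrite big_split /=; congr (_ + _).
  rewrite big_nat_recl // mulr0n add0r.
  by apply: eq_bigr => l _; rewrite subSS mulrnAl.
rewrite big_nat_recr //= subnn mulr0n addr0.
by apply: eq_big_nat => l /andP[_ lj]; rewrite subSn // mulrnAr.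
Qed.

Lemma tder1_is_additive : zmod_morphism tder1.
Proof. by move=> a b; apply/seriesP => j; rewrite /= mulrnBl. Qed.
HB.instance Definition _ :=
  GRing.isZmodMorphism.Build _ _ tder1 tder1_is_additive.

Lemma tder1_const (c : K) : tder1 c%:A = 0.
Proof. by apply/seriesP => j; rewrite /= mulr0 mul0rn. Qed.

Lemma tder1_tvar : tder1 tvar = 1.
Proof. by apply/seriesP => -[|j] /=; rewrite ?mulr1n // mul0rn. Qed.

Lemma tvarM_coef (a : series K tpow) (j : tpow) :
  (tvar * a) j = if j is j'.+1 then a j' else 0.
Proof.
rewrite tpow_coefM; case: j => [|j].
  by rewrite big_nat1 /= mul0r.
rewrite big_nat_recl // big_nat_recl //= mul0r add0r mul1r subSS subn0.
by rewrite big1 ?addr0 // => l _; rewrite mul0r.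
Qed.

Context {M : lfmonoidType}.
Implicit Types f g : series (series K tpow) M.

Definition tder f : series (series K tpow) M := Series (fun w => tder1 (f w)).

Lemma tder_is_additive : zmod_morphism tder.
Proof. by move=> f g; apply/seriesP => w; rewrite /= raddfB. Qed.
HB.instance Definition _ := GRing.isZmodMorphism.Build _ _ tder tder_is_additive.

Lemma tderM f g : tder (f * g) = tder f * g + f * tder g.
Proof.
apply/seriesP => w; rewrite scoefD !scoefM -big_split.
rewrite -[LHS]/(tder1 ((f * g) w)) scoefM raddf_sum.
by apply: eq_bigr => p _; apply: tder1M.
Qed.

Lemma tderZ a f : tder (a *: f) = tder1 a *: f + a *: tder f.
Proof. by apply/seriesP => w; rewrite scoefD !scoefZ -tder1M. Qed.

Lemma tder_const (f : series K M) : tder (tconst f) = 0.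
Proof. by apply/seriesP => w; apply: tder1_const. Qed.

Lemma tder_seriesX (m : M) : tder (seriesX _ m) = 0.
Proof.
rewrite (_ : seriesX _ m = tconst (seriesX K m)) ?tder_const //.
by apply/seriesP => w /=; case: eqP; rewrite ?scale1r ?scale0r.
Qed.

Lemma tder_scalar (a : series K tpow) :
  tder (a%:A : series (series K tpow) M) = (tder1 a)%:A.
Proof. by rewrite tderZ tder_seriesX scaler0 addr0. Qed.

Lemma tvarZ_inj : injective (fun f => tvar *: f).
Proof.
move=> f g e; apply/seriesP => w; apply/seriesP => j.
have /seriesP/(_ w)/seriesP/(_ j.+1) := e.
by rewrite !scoefZ !tvarM_coef.
Qed.

Definition at_t0 f : series K M := Series (fun w => f w (0%N : tpow)).

Lemma at_t0_is_additive : zmod_morphism at_t0.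
Proof. by move=> f g; apply/seriesP. Qed.
HB.instance Definition _ :=
  GRing.isZmodMorphism.Build _ _ at_t0 at_t0_is_additive.

Lemma at_t0M f g : at_t0 (f * g) = at_t0 f * at_t0 g.
Proof.
apply/seriesP => w; rewrite [LHS]scoef_sum; apply: eq_bigr => p _.
by rewrite tpow_coefM big_nat1.
Qed.

Lemma at_t0_tvarZ f : at_t0 (tvar *: f) = 0.
Proof. by apply/seriesP => w; exact: tvarM_coef. Qed.

Lemma at_t0_seriesX (m : M) : at_t0 (seriesX _ m) = seriesX K m.
Proof. by apply/seriesP => w /=; case: eqP. Qed.

Lemma at_t0_tconst (f : series K M) : at_t0 (tconst f) = f.
Proof. by apply/seriesP => w /=; rewrite mulr1. Qed.
End TimeDerivative.

Arguments tder {K M} f.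
Arguments at_t0 {K M} f.

(** * The derivations [u d/dz] *)

Section ZderFacts.
Context {R : comNzRingType} {k : zkind} {n : nat}.
Variable u : 'I_n -> series R (zmon k n).

HB.instance Definition _ :=
  GRing.isLinear.Build R _ _ _ (zder u) (zder_is_linear u).

Lemma zder_scalar c : zder u c%:A = 0.
Proof.
rewrite linearZ /=; suff -> : zder u 1 = 0 by rewrite scaler0.
have := zderM u 1 1; rewrite !mulr1 mul1r => /eqP.
by rewrite -subr_eq0 opprD addNKr oppr_eq0 => /eqP.
Qed.
End ZderFacts.

(** [u d/dz] f is bilinear in (u, f), and each of its coefficients is a finite
    sum, so the coefficient of t^j is a Cauchy product. *)
Lemma zder_tsum (K : comNzRingType) (k : zkind) (n : nat)
    (u : nat -> 'I_n -> series K (zmon k n)) (f : nat -> series K (zmon k n)) :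
  zder (fun i => tsum (fun j => u j i)) (tsum f) =
  tsum (fun j => \sum_(0 <= l < j.+1) zder (u l) (f (j - l)%N)).
Proof.
case: k u f => u f; apply/seriesP => w; apply/seriesP => j;
  rewrite [RHS]/= scoef_sum.
  rewrite [LHS]/= /cder !scoef_sum.
  rewrite [RHS](_ : _ = \sum_(0 <= l < j.+1) \sum_(i < n)
      (u l i * cpartial i (f (j - l)%N)) w); last first.
    by apply: eq_bigr => l _; apply: scoef_sum.
  rewrite [RHS]exchange_big; apply: eq_bigr => i _ /=.
  rewrite [RHS]exchange_big [LHS]scoef_sum; apply: eq_bigr => p _.
  rewrite tpow_coefM; apply: eq_bigr => l _ /=.
  by rewrite scoefMn.
rewrite [RHS](_ : _ = \sum_(0 <= l < j.+1) wder (u l) (f (j - l)%N) w);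
  last by rewrite -scoef_sum.
rewrite [RHS]exchange_big; apply: eq_bigr => p _.
rewrite [RHS]exchange_big [LHS]scoef_sum; apply: eq_bigr => q _.
rewrite [RHS]exchange_big [LHS]scoef_sum; apply: eq_bigr => i _.
by rewrite mulrC tpow_coefM; apply: eq_bigr => l _; apply: mulrC.
Qed.

(** * The Burgers equation *)

Section Burgers.
Variables (K : comNzRingType) (k : zkind) (n : nat).
Variable H : 'I_n -> series K (zmon k n).
Variables F G : {lrmorphism series (series K tpow) (zmon k n) ->
                            series (series K tpow) (zmon k n)}.
Hypothesis FE : forall i, F (zvar _ k i) = zvar _ k i - tvar *: tconst (H i).
Hypotheses (FK : cancel F G) (GK : cancel G F).
Variable Nt : 'I_n -> series (series K tpow) (zmon k n).
Hypothesis GE : forall i, G (zvar _ k i) = zvar _ k i + tvar *: Nt i.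

(** Apply G to F z_i = z_i - t H_i and cancel t. *)
Lemma inverse_tail i : Nt i = G (tconst (H i)).
Proof.
apply: (@tvarZ_inj K (zmon k n)); have := FK (zvar _ k i).
rewrite FE linearB linearZ /= GE -addrA -[RHS]addr0 => /addrI/eqP.
by rewrite subr_eq0 => /eqP.
Qed.

(** Both sides are derivations over K[[t]], although d_t and its conjugate are
    not, and both send z_i to N_{t,i}. *)
Lemma conj_tder f : tder f - G (tder (F f)) = zder Nt f.
Proof.
pose d : {additive _ -> _} := (tder \- (G \o tder \o F)) \- zder Nt.
apply/eqP; rewrite -subr_eq0; apply/eqP.
apply: (@zvar_rigidity _ _ k n d) => [c|i {}f] /=.
  rewrite zder_scalar subr0 linearZ rmorph1 tder_scalar linearZ /=.
  by rewrite rmorph1 subrr.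
have dF : tder (F (zvar _ k i)) = - tconst (H i).
  rewrite FE raddfB /= tder_seriesX tderZ tder_const scaler0 addr0.
  by rewrite tder1_tvar scale1r sub0r.
rewrite zderM zder_var rmorphM !tderM /= dF tder_seriesX mul0r add0r.
rewrite raddfD /= !rmorphM /= raddfN /= !FK -inverse_tail mulNr.
rewrite opprD opprK addrA opprD addrA !mulrBr; congr (_ - _).
by rewrite addrAC addrK.
Qed.

(** F N_{t,i} = H_i does not depend on t, so the conjugate of d_t kills
    N_{t,i}. *)
Lemma burgers i : zder Nt (Nt i) = tder (Nt i).
Proof.
have FN : F (Nt i) = tconst (H i) by rewrite inverse_tail GK.
by rewrite -conj_tder FN tder_const raddf0 subr0.
Qed.

(** G is the identity modulo t, by rigidity, and N_{t,i} = G (H_i). *)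
Lemma inverse_tail_t0 i : at_t0 (Nt i) = H i.
Proof.
pose d : {additive _ -> _} := (at_t0 \o G) \- at_t0.
have d0 : forall f, d f = 0.
  apply: (@zvar_rigidity _ _ k n d) => /= [c|j f].
    by rewrite linearZ rmorph1 subrr.
  rewrite rmorphM /= GE !at_t0M raddfD /= at_t0_tvarZ addr0 at_t0_seriesX.
  by rewrite mulrBr.
rewrite inverse_tail -[RHS]at_t0_tconst.
by apply/eqP; rewrite -subr_eq0; apply/eqP; apply: d0.
Qed.

Lemma inverse_tail_rec (N : nat -> 'I_n -> series K (zmon k n)) :
    (forall i, Nt i = tsum (fun j => N j.+1 i)) ->
  (forall i, N 1%N i = H i) /\
  (forall m i, (0 < m)%N ->
     \sum_(1 <= l < m) zder (N l) (N (m - l)%N i) = N m i *+ m.-1).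
Proof.
move=> NtE; split=> [i|m i].
  by rewrite -inverse_tail_t0 NtE; apply/seriesP.
case: m => // [[_|j _]]; first by rewrite big_geq // mulr0n.
(* The coefficient of t^j in the Burgers equation, with m = j + 2. *)
have := burgers i.
rewrite (_ : Nt = fun i => tsum (fun j => N j.+1 i)); last exact/funext.
rewrite zder_tsum => e; apply/seriesP => w.
have /seriesP/(_ w)/seriesP/(_ j) /= := e.
rewrite scoefMn => <-; rewrite -[X in \sum_(X <= _ < _) _]addn1.
rewrite big_addn subn1 /= !scoef_sum; apply: eq_big_nat => l /andP[_ lj].
by rewrite addn1 subSS subSn.
Qed.
End Burgers.

(** * Compositions and their first part *)

Lemma compositions_rec_fuel m p q : (0 < m)%N -> (m <= p)%N -> (m <= q)%N ->
  compositions_rec p m = compositions_rec q m.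
Proof.
elim: p m q => [|p IH] m [|q] m0 mp mq; rewrite ?leqn0 in mp mq; try lia.
rewrite /=; congr (_ :: flatten _); apply/eq_in_map => i.
rewrite mem_iota => mi; congr map; apply: IH; lia.
Qed.

Lemma compositionsS m : compositions m.+1 =
  [:: m.+1] :: [seq l :: c | l <- iota 1 m, c <- compositions_rec m (m.+1 - l)].
Proof. by []. Qed.

Lemma big_compositions (V : nmodType) (phi : seq nat -> V) m :
  \sum_(c <- compositions m | (2 <= size c)%N) phi c =
  \sum_(1 <= l < m) \sum_(c <- compositions (m - l)%N) phi (l :: c).
Proof.
case: m => [|m]; first by rewrite big_nil big_geq.
rewrite compositionsS big_cons (_ : (2 <= size [:: m.+1])%N = false) //.
rewrite big_mkcond big_allpairs_dep /index_iota subSS subn0.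
apply: eq_big_seq => l; rewrite mem_iota => lm.
rewrite (compositions_rec_fuel _ m (m.+1 - l)); [|lia..].
by apply: eq_big_seq => c; rewrite mem_compositions; case: c.
Qed.

(** The last partial sum of rev (i :: c) is the total; the earlier ones are the
    partial sums of rev c. *)
Lemma pi_u_rev_cons i c :
  pi_u (rev (i :: c)) = ((i + sumn c) * pi_u (rev c))%N.
Proof.
rewrite /pi_u rev_cons size_rcons big_nat_recr //= mulnC; congr (_ * _)%N.
  by rewrite take_oversize ?size_rcons // sumn_rcons sumn_rev addnC.
by apply: eq_big_nat => j /andP[_ jc]; rewrite -cats1 takel_cat.
Qed.

(** * The weighted sums over compositions *)

Section Weighted.
Variables (K : comAlgType rat) (k : zkind) (n : nat).
Variable N : nat -> 'I_n -> series K (zmon k n).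

Definition wterm c i : series K (zmon k n) :=
  (((pi_u (rev c))%:R^-1 : rat)%:A : K) *: iter_der N c i.

Lemma scale_in_algM (p q : rat) (f : series K (zmon k n)) :
  (p%:A : K) *: ((q%:A : K) *: f) = ((p * q)%:A : K) *: f.
Proof. by rewrite scalerA -scalerAl mul1r scalerA. Qed.

Lemma scale_in_alg_nat m (f : series K (zmon k n)) :
  ((m%:R : rat)%:A : K) *: f = f *+ m.
Proof. by rewrite !scaler_nat. Qed.

Lemma sum_wterm_ge2 m i :
  \sum_(c <- compositions m | (2 <= size c)%N) wterm c i =
  ((m%:R^-1 : rat)%:A : K) *: \sum_(1 <= l < m)
    zder (N l) (\sum_(c <- compositions (m - l)%N) wterm c i).
Proof.
rewrite big_compositions scaler_sumr; apply: eq_big_nat => l /andP[l0 lm].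
rewrite raddf_sum /= scaler_sumr; apply: eq_big_seq => c.
rewrite mem_compositions => /and3P[c0 _ /eqP sc].
rewrite linearZ /= scale_in_algM -invfM -natrM /wterm pi_u_rev_cons sc.
by rewrite subnKC ?(ltnW lm) //; case: c c0 {sc}.
Qed.

Lemma sum_wterm m i : (0 < m)%N ->
  \sum_(c <- compositions m) wterm c i =
  ((m%:R^-1 : rat)%:A : K) *: (N m i + \sum_(1 <= l < m)
    zder (N l) (\sum_(c <- compositions (m - l)%N) wterm c i)).
Proof.
case: m => // m _; rewrite scalerDr -sum_wterm_ge2 compositionsS !big_cons.
rewrite [(_ <= _)%N](_ : _ = false) //; congr (_ + _).
  by rewrite /wterm /= /pi_u big_nat1 /= addn0.
rewrite [RHS]big_mkcond; apply: eq_big_seq => c /allpairsPdep[l [d [+ + ->]]].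
rewrite mem_iota => lm; rewrite (compositions_rec_fuel _ m (m.+1 - l)); [|lia..].
by rewrite mem_compositions; case: d.
Qed.

Hypothesis N_rec : forall m i, (0 < m)%N ->
  \sum_(1 <= l < m) zder (N l) (N (m - l)%N i) = N m i *+ m.-1.

(** Inductively, m times the left side is N_[m] + (m - 1) N_[m]. *)
Lemma sum_wterm_id m i : (0 < m)%N ->
  \sum_(c <- compositions m) wterm c i = N m i.
Proof.
elim/ltn_ind: m => m IH m0; rewrite sum_wterm //.
under eq_big_nat => l /andP[l0 lm]
  do rewrite IH ?subn_gt0 // 1?ltn_subrL ?l0 //.
rewrite N_rec // -mulrS prednK // -scale_in_alg_nat scale_in_algM.
by rewrite mulVf ?Num.Theory.pnatr_eq0 -?lt0n // !scale1r.
Qed.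

Lemma sum_wterm_ge2_id m i : (2 <= m)%N ->
  N m i = ((m%:R / m.-1%:R : rat)%:A : K) *:
    \sum_(c <- compositions m | (2 <= size c)%N) wterm c i.
Proof.
move=> m2; rewrite sum_wterm_ge2.
under eq_big_nat => l /andP[l0 lm] do rewrite sum_wterm_id ?subn_gt0 //.
rewrite N_rec ?(ltnW m2) // -scale_in_alg_nat !scale_in_algM.
rewrite mulrAC divfK ?divff ?Num.Theory.pnatr_eq0 ?scale1r //; lia.
Qed.
End Weighted.

Theorem proposition5p8 (K : comAlgType rat) (k : zkind) (n alpha : nat)
    (alpha_ge1 : (1 <= alpha)%N)
    (H : 'I_n -> series K (zmon k n))
    (F G : {lrmorphism series (series K tpow) (zmon k n) ->
                       series (series K tpow) (zmon k n)})
    (F_Et : is_Et alpha H F)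
    (FK : cancel F G) (GK : cancel G F)
    (Nt : 'I_n -> series (series K tpow) (zmon k n))
    (G_Nt : forall i, G (zvar _ k i) = zvar _ k i + tvar *: Nt i)
    (N : nat -> 'I_n -> series K (zmon k n))
    (Nt_N : forall i, Nt i = tsum (fun j => N j.+1 i)) :
  (forall i, N 1%N i = H i) /\
  (forall m, (2 <= m)%N -> forall i,
     N m i =
     ((m%:R / (m.-1)%:R : rat)%:A : K) *:
       \sum_(c <- compositions m | (2 <= size c)%N)
         (((pi_u (rev c))%:R^-1 : rat)%:A : K) *: iter_der N c i).
Proof.
have [_ _ FE] := F_Et.
have [N1 N_rec] := inverse_tail_rec _ _ _ _ _ _ FE FK GK _ G_Nt _ Nt_N.
by split=> // m m2 i; apply: sum_wterm_ge2_id.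
Qed.
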